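(* Let $A\subset\mathbb{C}$ be a finite set with $0\notin A$ and $|A|>1$. There exist two disjoint subsets $B$ and $C$ of $A$, each of cardinality at least $|A|/3$, such that $$\mathsf{E}^\times(B)\cdot\mathsf{E}^+(C)^3\lesssim |A|^{11}.$$
   Context: For a finite set $X\subset\mathbb{C}$, $\mathsf{E}^+(X)$ is the number of $(x_1,x_2,x_3,x_4)\in X^4$ with $x_1+x_3=x_2+x_4$ (additive energy), and $\mathsf{E}^\times(X)$ is the number of $(x_1,x_2,x_3,x_4)\in X^4$ with $x_1x_3=x_2x_4$ (multiplicative energy). $U\lesssim V$ means $U\le C_0(\log|A|)^{C_0}V$ for some absolute constant $C_0>0$ (independent of $A$). *)

(* Defs.v *)
From HB Require Import structures.
From mathcomp Require Import all_boot all_order all_algebra finmap.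
From mathcomp Require Import complex.
From mathcomp Require Import reals exp.

Set Implicit Arguments.
Unset Strict Implicit.
Unset Printing Implicit Defensive.

Import Order.TTheory GRing.Theory Num.Theory.

Local Open Scope fset_scope.
Local Open Scope ring_scope.

Definition add_energy (K : zmodType) (X : {fset K}) : nat :=
  #|` [fset q in X `*` X `*` X `*` X |
        let: (x1, x2, x3, x4) := q in x1 + x3 == x2 + x4] |.

Definition mul_energy (K : nzRingType) (X : {fset K}) : nat :=
  #|` [fset q in X `*` X `*` X `*` X |
        let: (x1, x2, x3, x4) := q in x1 * x3 == x2 * x4] |.

(* Base 2, so that log2 n >= 1 for n >= 2 and C0 * log2 n `^ C0 is
   nondecreasing in C0 > 0; with ln 2 < 1 a large C0 would make
   C0 * ln 2 `^ C0 arbitrarily small. *)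
Definition log2 (R : realType) (x : R) : R := ln x / ln 2.

(* U <~ V relative to a set of n elements, with the constant C0 exposed so
   that it can be quantified before the set. *)
Definition polylog_le (R : realType) (C0 : R) (n : nat) (U V : R) : Prop :=
  U <= C0 * (log2 n%:R `^ C0) * V.

(* Main.v *)
Require Import Defs.
From HB Require Import structures.
From mathcomp Require Import all_boot all_order all_algebra finmap.
From mathcomp Require Import complex.
From mathcomp Require Import reals exp.
From mathcomp Require Import zify ring lra.

Set Implicit Arguments.
Unset Strict Implicit.
Unset Printing Implicit Defensive.

Import Order.TTheory GRing.Theory Num.Theory.

(** Write E+ and Ex for the two energies, n for the size of A, and ignore
    logarithmic factors.

    The geometric input is a Szemeredi-Trotter bound for a square grid in the
    complex plane ([complex_rich_lines_bound]): at most O(|S|^4 / k^3) lines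
    y = x s + e contain k points of the grid S * S.  The argument is that of
    Solymosi and Tardos.  On a k-rich line, join each abscissa s to the nearest
    other abscissa s' on the same line.  The discs centred at s with s' on the
    boundary overlap boundedly ([bounded_overlap]), so for at least half of the
    points they contain O(|S| / k) elements of S; as a complex affine map is a
    similarity, the same holds for the images.  Hence the line is spanned by k/2
    or more pairs of grid points that come from a collection of only
    O((|S|^2 / k)^2) pairs, and each pair determines its line.

    Summed over dyadic levels of richness, this bounds the number Q_S(X) of
    solutions of p - x p' = q - x q' with p, p', q, q' in S and x in a set X of
    nonzero slopes: it is O(|X|^(1/2) |S|^3 + |X| |S|^2) ([line_energy_bound]).

    The heart of the matter ([energy_tradeoff]) is that any nonempty finite set C
    without 0 contains a nonempty B with Ex(B) E+(C)^3 <= O(|C|^7 |B|^4).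
    Dyadic pigeonholing gives t and a set P of differences, each with at least t
    representations in C, with E+(C) about |P| t^2; then s and a set B of those
    b in C such that b - p lies in C for at least s of the p in P, with
    |P| t about s |B|; then k and a set X of ratios, each attained at least k
    times in B, with Ex(B) about k^2 |X|.  Writing both sides of b = x b'
    as c + p = x (c' + p') yields |X| k s^2 solutions of
    p - x p' = -(c - x c'), so (|X| k s^2)^2 <= Q_P(X) Q_C(X) by
    Cauchy-Schwarz, and inserting the bounds for Q gives the inequality.

    Finally, Ex^(1/4) is subadditive on disjoint unions ([div_energy_cat]) and
    E+ is monotone, so a pair (B, A \ B) with Ex(B) E+(A \ B)^3 <= D |B|^4,
    where D is of order n^7, keeps this property when the subset of A \ B
    supplied by [energy_tradeoff] is moved into B.  Starting from the empty set,
    B reaches any prescribed size; take a third of n, rounded up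
    ([balanced_split]). *)

Local Open Scope nat_scope.

(** * Finite sums and dyadic pigeonholing *)

Lemma size_filter_sum (T : Type) (p : pred T) (s : seq T) :
  size [seq x <- s | p x] = \sum_(x <- s) p x.
Proof.
by rewrite size_filter -sum1_count big_mkcond; apply: eq_bigr => x _; case: (p x).
Qed.

Lemma sum_nat_cauchy_schwarz (I : Type) (s : seq I) (u v : I -> nat) :
  (\sum_(i <- s) u i * v i) ^ 2
    <= (\sum_(i <- s) u i ^ 2) * (\sum_(i <- s) v i ^ 2).
Proof.
rewrite -(leq_pmul2l (isT : 0 < 2)) -mulnn !big_distrlr /=.
rewrite [leqRHS]mul2n -addnn [X in _ <= _ + X]exchange_big /= -big_split big_distrr /=.
apply: leq_sum => i _; rewrite -big_split big_distrr /=.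
apply: leq_sum => j _.
apply: leq_trans (leq_trans (nat_Cauchy (u i * v j) (u j * v i)).1 _).
  by apply: eq_leq; ring.
by apply: eq_leq; ring.
Qed.

(** Markov's inequality for the e-th power. *)
Lemma sum_nat_filter_ge (I : Type) (s : seq I) (w : I -> nat) e k :
  k ^ e * size [seq i <- s | k <= w i] <= \sum_(i <- s) w i ^ e.
Proof.
rewrite size_filter_sum big_distrr leq_sum // => i _ /=.
case: (leqP k) => ki; last by rewrite muln0.
rewrite muln1.
by case: e => // e; rewrite leq_exp2r.
Qed.

(** The nonzero values of [w] fall into [J] dyadic ranges; [k] is the lower end of the
    range that contributes most, and all [i] with [w i] at least [k] are kept
    because only a lower bound on their values is used afterwards. *)
Lemma dyadic_pigeonhole (I : eqType) (s : seq I) (w : I -> nat) e J :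
  0 < J -> 0 < e -> {in s, forall i, w i < 2 ^ J} ->
  exists2 k, 0 < k &
    \sum_(i <- s) w i ^ e <= J * (2 ^ e * k ^ e * size [seq i <- s | k <= w i]).
Proof.
case: J => // J _ e_gt0 wJ.
pose F j := 2 ^ e * (2 ^ j) ^ e * size [seq i <- s | 2 ^ j <= w i].
have [j0 Fj0]: exists j0, forall j : 'I_J.+1, F j <= F j0.
  have := @arg_maxnP _ (ord0 : 'I_J.+1) xpredT F isT.
  by case=> j _ jmax; exists j => i; exact: jmax.
exists (2 ^ j0); first by rewrite expn_gt0.
apply: (@leq_trans (\sum_(j < J.+1) F j)); last first.
  apply: leq_trans (leq_sum _ _) _ => [j _|]; first exact: Fj0.
  by rewrite sum_nat_const card_ord.
rewrite {Fj0}/F.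
under [leqRHS]eq_bigr do rewrite size_filter_sum big_distrr.
rewrite exchange_big /= !big_seq; apply: leq_sum => i si.
have [->|w_gt0] := posnP (w i); first by rewrite exp0n.
have /andP[lo hi] := trunc_log_bounds (isT : 1 < 2) w_gt0.
have jJ : trunc_log 2 (w i) < J.+1.
  by rewrite -(ltn_exp2l _ _ (isT : 1 < 2)); apply: leq_ltn_trans lo (wJ i si).
rewrite (bigD1 (Ordinal jJ)) //= lo muln1; apply: leq_trans (leq_addr _ _).
by rewrite -expnMn -expnS leq_exp2r // ltnW.
Qed.

(** * Collisions of two maps *)

(** Energies, the number of solutions of a linear equation and the mixed counts
    that Cauchy-Schwarz compares are all of this form. *)
Definition collisions (I J : Type) (T : eqType) (rI : seq I) (rJ : seq J)
  (f : I -> T) (g : J -> T) : nat :=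
  \sum_(i <- rI) \sum_(j <- rJ) (f i == g j).

Definition fiber_size (I : Type) (T : eqType) (rI : seq I) (f : I -> T) (z : T) : nat :=
  \sum_(i <- rI) (f i == z).

Lemma sum_indicator (T : eqType) (s : seq T) x (F : T -> nat) :
  uniq s -> x \in s -> \sum_(z <- s) (x == z) * F z = F x.
Proof.
move=> us xs; rewrite (bigD1_seq x) //= eqxx mul1n big1 ?addn0 // => z.
by rewrite eq_sym => /negPf->.
Qed.

Lemma sum_indicator_le (T : eqType) (s : seq T) x (F : T -> nat) :
  uniq s -> \sum_(z <- s) (x == z) * F z <= F x.
Proof.
move=> us; have [xs|xs] := boolP (x \in s); first by rewrite sum_indicator.
rewrite big_seq big1 // => z zs.
by case: eqP => [xz|]; rewrite ?mul0n //; move: xs; rewrite xz zs.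
Qed.

Lemma sum_fiber_size (I : eqType) (T : eqType) (rI : seq I) (f : I -> T) (Z : seq T) :
  uniq Z -> {in rI, forall i, f i \in Z} -> \sum_(z <- Z) fiber_size rI f z = size rI.
Proof.
move=> uZ fZ; rewrite exchange_big /= -sum1_size !big_seq.
apply: eq_bigr => i /fZ fi; under eq_bigr do rewrite -[X in nat_of_bool X]andbT -mulnb.
by rewrite (sum_indicator (fun=> 1)).
Qed.

Lemma collisions_fiber_size (I : eqType) (J : Type) (T : eqType) (rI : seq I) (rJ : seq J)
  (f : I -> T) (g : J -> T) (Z : seq T) :
  uniq Z -> {in rI, forall i, f i \in Z} ->
  collisions rI rJ f g = \sum_(z <- Z) fiber_size rI f z * fiber_size rJ g z.
Proof.
move=> uZ fZ; rewrite /fiber_size; under [RHS]eq_bigr do rewrite big_distrl.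
rewrite exchange_big /= /collisions !big_seq; apply: eq_bigr => i /fZ fi /=.
rewrite (sum_indicator (fun z => \sum_(j <- rJ) (g j == z))) //.
by apply: eq_bigr => j _; rewrite eq_sym.
Qed.

Lemma fiber_size_le_size (I : Type) (T : eqType) (rI : seq I) (f : I -> T) z :
  fiber_size rI f z <= size rI.
Proof. by rewrite -sum1_size leq_sum // => i _; case: eqP. Qed.

Lemma collisions_self_fiber_size (I : eqType) (T : eqType) (rI : seq I) (f : I -> T) :
  collisions rI rI f f = \sum_(z <- undup (map f rI)) fiber_size rI f z ^ 2.
Proof.
rewrite (@collisions_fiber_size _ _ _ _ _ _ _ (undup (map f rI))) ?undup_uniq //.
by move=> i ri; rewrite mem_undup map_f.
Qed.

(** Both sides are sums over the common values of the products of fibre sizes. *)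
Lemma collisions_cauchy_schwarz (I J T : eqType) (rI : seq I) (rJ : seq J)
  (f : I -> T) (g : J -> T) :
  collisions rI rJ f g ^ 2 <= collisions rI rI f f * collisions rJ rJ g g.
Proof.
pose Z := undup (map f rI ++ map g rJ).
have uZ : uniq Z by apply: undup_uniq.
have fZ : {in rI, forall i, f i \in Z}.
  by move=> i ri; rewrite mem_undup mem_cat map_f.
have gZ : {in rJ, forall i, g i \in Z}.
  by move=> i ri; rewrite mem_undup mem_cat orbC map_f.
by rewrite !(collisions_fiber_size _ _ uZ) //; apply: sum_nat_cauchy_schwarz.
Qed.

Lemma collisions_self_ge (I T : eqType) (rI : seq I) (f : I -> T) :
  size rI <= collisions rI rI f f.
Proof.
rewrite /collisions -sum1_size !big_seq; apply: leq_sum => i ri.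
by rewrite (big_rem i) //= eqxx.
Qed.

Definition pairs (S T : Type) (A : seq S) (B : seq T) := [seq (a, b) | a <- A, b <- B].

Lemma big_pairs (S T : Type) (A : seq S) (B : seq T) (F : S * T -> nat) :
  \sum_(p <- pairs A B) F p = \sum_(a <- A) \sum_(b <- B) F (a, b).
Proof. by rewrite /pairs big_allpairs. Qed.

Lemma mem_pairs (S T : eqType) (A : seq S) (B : seq T) p :
  (p \in pairs A B) = (p.1 \in A) && (p.2 \in B).
Proof.
case: p => a b; apply/allpairsP/andP => [[[x y] [/= xA yB [-> ->]]]|[aA bB]] //.
by exists (a, b).
Qed.

Lemma uniq_pairs (S T : eqType) (A : seq S) (B : seq T) :
  uniq A -> uniq B -> uniq (pairs A B).
Proof. by move=> uA uB; apply: allpairs_uniq => // -[a b] [c d]. Qed.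

Lemma size_pairs (S T : Type) (A : seq S) (B : seq T) :
  size (pairs A B) = size A * size B.
Proof. exact: size_allpairs. Qed.

Local Open Scope ring_scope.

(** * Discs in the complex plane *)

Definition sqnorm (R : rcfType) (z : complex R) : R :=
  complex.Re z ^+ 2 + complex.Im z ^+ 2.

Lemma sqnormM (R : rcfType) (z w : complex R) : sqnorm (z * w) = sqnorm z * sqnorm w.
Proof. by case: z w => [a b] [c d]; rewrite /sqnorm /=; ring. Qed.

Lemma sqnorm_gt0 (R : rcfType) (z : complex R) : z != 0 -> 0 < sqnorm z.
Proof.
case: z => a b; rewrite eq_complex /= negb_and /sqnorm /= => ab0.
rewrite lt_def addr_ge0 ?sqr_ge0 // andbT paddr_eq0 ?sqr_ge0 //.
by rewrite !sqrf_eq0 negb_and.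
Qed.

(** Within an angle of 45 degrees subtraction shortens the longer vector [(x, y)];
    this needs the inner product to exceed half of the squared length of the
    shorter one.  Equality would force [x' = y' = x] and [y = 0], and then
    [(x', y')] would be the longer vector. *)
Lemma octant_sub_lt (R : realFieldType) (x y x' y' : R) :
  0 <= y <= x -> 0 <= y' <= x' -> 0 < x' -> x' ^+ 2 + y' ^+ 2 <= x ^+ 2 + y ^+ 2 ->
  (x - x') ^+ 2 + (y - y') ^+ 2 < x ^+ 2 + y ^+ 2.
Proof.
move=> /andP[y0 yx] /andP[y'0 y'x'] x'0 le.
suff : x' ^+ 2 + y' ^+ 2 < 2 * (x * x' + y * y') by move: le; nra.
have yy : 0 <= y * y' by exact: mulr_ge0.
have [xx'|x'x] := ltP x x'.
  apply: (le_lt_trans le).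
  have [x0|x0] := ltP 0 x.
    have : x * x < x * x' by rewrite ltr_pM2l.
    have : y * y <= x * x by apply: ler_pM.
    by nra.
  have : x = 0 by lra.
  have : y = 0 by lra.
  have : 0 < x' * x' by apply: mulr_gt0.
  have : 0 <= y' * y' by apply: mulr_ge0.
  by move=> ? ? y00 x00; rewrite y00 x00 !expr2 in le *; lra.
have h1 : x' * x' <= x * x' by rewrite ler_pM2r.
have h2 : y' * y' <= x' * x' by apply: ler_pM.
have [//|h] := ltP (x' ^+ 2 + y' ^+ 2) (2 * (x * x' + y * y')).
rewrite !expr2 in le h *.
have e1 : x' * x' = x * x' by lra.
have ex : x' = x by apply: (mulIf (lt0r_neq0 x'0)).
subst x'; have ey : y' * y' = x * x by lra.
have : y * y' = 0 by lra.
have xx : 0 < x * x by apply: mulr_gt0.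
by move=> /eqP; rewrite mulf_eq0 => /orP[]/eqP y00; rewrite y00 ?mul0r in ey le *; lra.
Qed.

Lemma same_sign_sub (R : realFieldType) (a b : R) :
  (0 <= a) = (0 <= b) -> (a - b) ^+ 2 = (`|a| - `|b|) ^+ 2.
Proof.
have [a0 /esym b0|a0 /esym/negbT] := leP 0 a; first by rewrite !ger0_norm.
by rewrite -ltNge => b0; rewrite !ltr0_norm //; ring.
Qed.

(** The eight sectors of 45 degrees cut out by the axes and the diagonals. *)
Definition octant (R : rcfType) (z : complex R) : bool * bool * bool :=
  (0 <= complex.Re z, 0 <= complex.Im z, `|complex.Im z| <= `|complex.Re z|).

Lemma octant_closer (R : rcfType) (u v : complex R) :
  octant u = octant v -> v != 0 -> sqnorm v <= sqnorm u -> sqnorm (u - v) < sqnorm u.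
Proof.
case: u v => [a b] [c d] [/= sa sb st] /sqnorm_gt0.
rewrite /sqnorm /= !(same_sign_sub sa, same_sign_sub sb).
rewrite -!(real_normK (num_real a), real_normK (num_real b),
           real_normK (num_real c), real_normK (num_real d)).
move: st (normr_ge0 a) (normr_ge0 b) (normr_ge0 c) (normr_ge0 d).
set a' := `|a|; set b' := `|b|; set c' := `|c|; set d' := `|d|.
move=> st a0 b0 c0 d0 v0 le.
have [ba|ab] := leP b' a'; move: st.
  rewrite ba => /esym dc; apply: octant_sub_lt => //; rewrite ?b0 ?d0 //.
  by rewrite lt_neqAle c0 andbT; apply/eqP => c0'; move: v0 dc; rewrite -c0'; nra.
rewrite leNgt ab /= => /esym/negbT; rewrite -ltNge => cd.
rewrite [ltLHS]addrC [ltRHS]addrC; apply: octant_sub_lt.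
- by rewrite a0 ltW.
- by rewrite c0 ltW.
- exact: le_lt_trans cd.
- by rewrite addrC [leRHS]addrC.
Qed.

(** Seen from [z], two centres in the same octant are closer to each other than
    the farther of them is to [z], so [z] cannot lie in both discs.  This leaves
    one centre per octant, and possibly [z] itself. *)
Lemma bounded_overlap (R : rcfType) (T : seq (complex R))
  (rho : complex R -> R) (z : complex R) :
  uniq T -> {in T &, forall c c', c != c' -> rho c <= sqnorm (c' - c)} ->
  (size [seq c <- T | (sqnorm (z - c) <= rho c)%R] <= 9)%N.
Proof.
move=> uT sep; set D := filter _ _.
have uD : uniq D by apply: filter_uniq.
(* z itself is removed: its difference with z is 0, which has no direction *)
pose D' := rem z D.
have sD : (size D <= (size D').+1)%N.
  by rewrite /D'; case: (boolP (z \in D)) => [/size_rem->|/rem_id->] //; case: (size D).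
apply: leq_trans sD _; rewrite ltnS.
pose col c := octant (z - c).
suff icol : {in D' &, injective col}.
  have : uniq (map col D') by rewrite map_inj_in_uniq ?rem_uniq.
  move=> /card_uniqP; rewrite size_map => <-.
  by apply: leq_trans (max_card _) _; rewrite !card_prod card_bool.
have main c c' : c \in D' -> c' \in D' -> col c = col c' ->
    sqnorm (z - c') <= sqnorm (z - c) -> c = c'.
  rewrite !mem_rem_uniq // !inE !mem_filter.
  move=> /and3P[cz cr cT] /and3P[c'z c'r c'T] ecol le; apply/eqP/negP => /negP ne.
  have := octant_closer ecol; rewrite subr_eq0 eq_sym => /(_ c'z le).
  have -> : z - c - (z - c') = c' - c by ring.
  by move=> /(le_lt_trans (sep _ _ cT c'T ne)) /(le_lt_trans cr); rewrite ltxx.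
move=> c c' cD c'D e; have [le|/ltW le] := leP (sqnorm (z - c')) (sqnorm (z - c)).
  exact: main.
by apply/esym/main.
Qed.

Definition argmin (T : eqType) (R : realDomainType) (f : T -> R) (x0 : T) (s : seq T) :=
  foldr (fun x y => if f x <= f y then x else y) x0 s.

Lemma argmin_mem (T : eqType) (R : realDomainType) (f : T -> R) x0 s :
  argmin f x0 s \in x0 :: s.
Proof.
elim: s => [|x s IH] /=; first by rewrite inE.
case: ifP => _; rewrite !inE ?eqxx ?orbT //.
by move: IH; rewrite inE => /orP[] ->; rewrite ?orbT.
Qed.

Lemma argmin_le (T : eqType) (R : realDomainType) (f : T -> R) x0 s y :
  y \in x0 :: s -> f (argmin f x0 s) <= f y.
Proof.
elim: s => [|x s IH] /=; first by rewrite inE => /eqP->.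
rewrite !inE orbCA => /orP[/eqP->|ys].
  by case: ifP => // /negbT; rewrite -ltNge => /ltW.
have := IH; rewrite inE ys => /(_ isT); case: ifP => // h; exact: le_trans.
Qed.

Definition nearest (R : rcfType) (T : seq (complex R)) (c : complex R) :=
  let s := rem c T in argmin (fun b => sqnorm (b - c)) (head c s) s.

Lemma nearestP (R : rcfType) (T : seq (complex R)) (c : complex R) :
  uniq T -> c \in T -> (1 < size T)%N ->
  [/\ nearest T c \in T, nearest T c != c &
      {in T, forall b, b != c -> sqnorm (nearest T c - c) <= sqnorm (b - c)}].
Proof.
move=> uT cT T2; rewrite /nearest; set s := rem c T; set f := fun b => _.
have hs : head c s \in s.
  have : size s = (size T).-1 by apply: size_rem.
  by case: (s) => [|x t] /=; rewrite ?mem_head //; case: (size T) T2 => [|[]].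
have : argmin f (head c s) s \in s.
  by have := argmin_mem f (head c s) s; rewrite inE => /orP[/eqP->|].
rewrite mem_rem_uniq // inE => /andP[ne ->]; split=> // b bT bc.
by apply: (@argmin_le _ _ f); rewrite inE mem_rem_uniq // !inE bc bT orbT.
Qed.

Definition ball (R : rcfType) (S : seq (complex R)) (c b : complex R) :=
  [seq z <- S | sqnorm (z - c) <= sqnorm (b - c)].

(** The discs are closed, so that ties in the distance cannot make the left-hand
    side large: all these [b] lie in the disc of the farthest of them. *)
Lemma few_small_balls (R : rcfType) (S : seq (complex R)) c k M :
  uniq S -> (k * size [seq b <- S | k * size (ball S c b) <= M] <= M)%N.
Proof.
move=> uS; set F := filter _ _.
have [->|] := eqVneq F [::]; first by rewrite muln0.
case eF : F => [//|b0 F'] _; rewrite -eF.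
pose b := argmin (fun b => - sqnorm (b - c)) b0 F'.
have bF : b \in F by rewrite eF; apply: argmin_mem.
have : (size F <= size (ball S c b))%N.
  apply: uniq_leq_size => [|z zF]; first exact: filter_uniq.
  have zS : z \in S by move: zF; rewrite mem_filter => /andP[].
  rewrite mem_filter zS andbT -lerN2.
  by apply: (@argmin_le _ _ (fun b => - sqnorm (b - c))); rewrite -eF.
move: bF; rewrite mem_filter => /andP[bM _] le; apply: leq_trans bM.
by rewrite leq_mul2l le orbT.
Qed.

(** * Rich lines in a complex grid *)

Definition rich_pts (K : nzRingType) (S : seq K) (l : K * K) :=
  [seq s <- S | l.1 * s + l.2 \in S].

(** The affine map [c |-> x * c + e] multiplies squared distances by the squared
    norm of [x], so pulling [z] back to [(z - e) / x] reduces the claim to the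
    bounded overlap of the discs before the map is applied. *)
Lemma sum_ball_nearest (R : rcfType) (S T : seq (complex R)) (x e : complex R) :
  uniq T -> (1 < size T)%N -> x != 0 ->
  (\sum_(c <- T) size (ball S (x * c + e)%R (x * nearest T c + e)%R) <= 9 * size S)%N.
Proof.
move=> uT T2 x0; under eq_bigr do rewrite size_filter_sum.
rewrite exchange_big /= mulnC -sum1_size big_distrl; apply: leq_sum => z _ /=.
pose rho c := sqnorm (nearest T c - c).
apply: leq_trans (bounded_overlap ((z - e) / x) (rho := rho) uT _); last first.
  move=> c c' cT c'T cc'; have [_ _] := nearestP uT cT T2; apply=> //.
  by rewrite eq_sym.
rewrite size_filter_sum; apply: eq_leq; apply: eq_bigr => c _; congr nat_of_bool.
have -> : z - (x * c + e) = x * ((z - e) / x - c) by field.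
have -> : x * nearest T c + e - (x * c + e) = x * (nearest T c - c) by ring.
by rewrite !sqnormM ler_pM2l // sqnorm_gt0.
Qed.

(** The second point is among the [36 * size S / k] nearest neighbours of the
    first one, counting ties. *)
Definition close_pair (R : rcfType) (S : seq (complex R)) (k : nat) (p : complex R * complex R) :=
  (k * size (ball S p.1 p.2) <= 36 * size S)%N.

(** The discs around the [m] points of a rich line and around their images have
    total size at most [9 + 9 = 18] times [size S], so by Markov at most half of
    the points have discs that exceed twice the average [18 * size S / m]. *)
Lemma many_close_pairs (R : rcfType) (S : seq (complex R)) (l : complex R * complex R) k :
  uniq S -> l.1 != 0 -> (1 < k)%N ->
  (k <= size (rich_pts S l))%N ->
  (k <= 2 * size [seq c <- rich_pts S l |
     close_pair S k (c, nearest (rich_pts S l) c) &&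
     close_pair S k (l.1 * c + l.2, l.1 * nearest (rich_pts S l) c + l.2)%R])%N.
Proof.
case: l => x e /= uS x0 k2; set T := rich_pts S _ => kT.
have uT : uniq T by apply: filter_uniq.
have T2 : (1 < size T)%N by apply: leq_trans kT.
have S_gt0 : (0 < size S)%N.
  by apply: leq_trans (leq_trans (ltnW T2) _); rewrite // size_filter count_size.
clearbody T.
(* the first disc is written as an image under the identity line, so that
   sum_ball_nearest applies to both *)
pose D c := (size (ball S (1 * c + 0)%R (1 * nearest T c + 0)%R)
  + size (ball S (x * c + e)%R (x * nearest T c + e)%R))%N.
have sumD : (\sum_(c <- T) D c <= 18 * size S)%N.
  rewrite big_split /= (_ : 18 = 9 + 9)%N // mulnDl leq_add //; apply: sum_ball_nearest => //.
  exact: oner_neq0.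
set good := filter _ _.
pose bad := [seq c <- T | (36 * size S < k * D c)%N].
have Tgb : (size T <= size good + size bad)%N.
  rewrite !size_filter -(count_predC [pred c | (k * D c <= 36 * size S)%N]).
  apply: leq_add; last by apply: sub_count => c /=; rewrite ltnNge.
  apply: sub_count => c /= h; rewrite /close_pair /=.
  apply/andP; split; apply: leq_trans h;
  by rewrite leq_mul2l /D !mul1r !addr0 ?leq_addl ?leq_addr orbT.
have : (36 * size S * size bad <= k * (18 * size S))%N.
  apply: leq_trans (leq_mul (leqnn k) sumD).
  rewrite big_distrr /= size_filter_sum big_distrr /=; apply: leq_sum => c _.
  by case: ltnP => h; rewrite ?muln0 // muln1 ltnW.
have -> : (k * (18 * size S) = 18 * size S * k)%N by ring.
have -> : (36 * size S * size bad = 18 * size S * (2 * size bad))%N by ring.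
rewrite leq_pmul2l ?muln_gt0 ?S_gt0 //; move: Tgb kT.
move: (size bad) (size good) (size T) => b g t; lia.
Qed.

(** The Szemeredi-Trotter bound for square grids, with constant [c]. The
    rest of the argument is valid over any field with such a bound. *)
Definition rich_lines_bound (K : fieldType) (c : nat) :=
  forall (S : seq K) (L : seq (K * K)) (k : nat),
    uniq S -> uniq L -> (1 < k)%N ->
    {in L, forall l, l.1 != 0 /\ (k <= size (rich_pts S l))%N} ->
    (size L * k ^ 3 <= c * size S ^ 4)%N.

(** A rich line and a point on it such that both the abscissa and the ordinate
    are close to those of the neighbouring point determine two close pairs of
    [S], and conversely these two pairs determine the line.  Close pairs number
    at most [36 * size S ^ 2 / k], which gives
    [size L * k / 2 <= (36 * size S ^ 2 / k) ^ 2]; here [2592 = 2 * 36 ^ 2]. *)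
Lemma complex_rich_lines_bound (R : rcfType) : rich_lines_bound (complex R) 2592.
Proof.
move=> S L k uS uL k2 richL.
pose T := rich_pts S.
pose good l := [seq c <- T l | close_pair S k (c, nearest (T l) c) &&
     close_pair S k (l.1 * c + l.2, (l.1 * nearest (T l) c + l.2)%R)].
pose G := [seq (l, c) | l <- L, c <- good l].
pose Near := [seq p <- pairs S S | close_pair S k p].
pose phi (g : (complex R * complex R) * complex R) :=
  let: (l, c) := g in
  ((c, nearest (T l) c), (l.1 * c + l.2, l.1 * nearest (T l) c + l.2)).
have uT l : uniq (T l) by apply: filter_uniq.
have GP g : g \in G -> exists l c, [/\ g = (l, c), l \in L, c \in T l,
     close_pair S k (c, nearest (T l) c) /\
     close_pair S k (l.1 * c + l.2, l.1 * nearest (T l) c + l.2)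
     & [/\ nearest (T l) c \in T l & nearest (T l) c != c]].
  case/allpairsPdep => l [c [lL]]; rewrite mem_filter => /andP[/andP[h1 h2] cT] ->.
  exists l, c; split=> //; have [] := nearestP (uT l) cT => //.
  by apply: leq_trans (richL l lL).2.
have sizeG : (size L * k <= 2 * size G)%N.
  rewrite /G size_allpairs_dep sumnE big_map big_distrr /= mulnC.
  rewrite -(sum1_size L) big_distrr /= !big_seq; apply: leq_sum => l lL.
  have [l0 kl] := richL l lL; rewrite muln1; exact: many_close_pairs.
have uG : uniq G.
  apply: allpairs_uniq_dep => // [l _|]; first exact/filter_uniq/uT.
  by move=> [l c] [l' c'] _ _ /= [-> ->].
have GNear : (size G <= size (pairs Near Near))%N.
  rewrite -(size_map phi); apply: uniq_leq_size.
    rewrite map_inj_in_uniq // => g g' /GP[l [c [-> _ _ _ [_ nc]]]] /GP[l' [c' [-> _ _ _ _]]].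
    case: l l' nc => [x e] [x' e'] /= nc [] ecc'; rewrite -!{}ecc' => en; rewrite -!{}en => e1 e2.
    have exx' : x = x'.
      apply: (@mulIf _ (nearest (T (x, e)) c - c)); first by rewrite subr_eq0.
      set b := nearest _ _ in e2 *.
      have -> : x * (b - c) = (x * b + e) - (x * c + e) by ring.
      by rewrite e1 e2; ring.
    by move: e1; rewrite exx' => /addrI->.
  move=> _ /mapP[g /GP[l [c [-> lL cT [h1 h2] [nT nc]]]] ->].
  move: cT nT; rewrite !mem_pairs /= !mem_filter !mem_pairs h1 h2 /=.
  by move=> /andP[-> ->] /andP[-> ->].
have kNear : (k * size Near <= 36 * size S * size S)%N.
  rewrite size_filter_sum big_pairs big_distrr /= mulnC -{1}(sum1_size S) big_distrl /=.
  apply: leq_sum => c _; rewrite mul1n -size_filter_sum.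
  exact: few_small_balls.
have {GNear}: (size L * k * k ^ 2 <= 2 * (36 * size S * size S) ^ 2)%N.
  apply: leq_trans (leq_mul sizeG (leqnn _)) _.
  rewrite -mulnA leq_mul2l /=; apply: leq_trans (leq_mul GNear (leqnn _)) _.
  rewrite size_pairs mulnn -expnMn leq_exp2r //; rewrite mulnC; exact: kNear.
have -> : (size L * k * k ^ 2 = size L * k ^ 3)%N by ring.
by have -> : (2 * (36 * size S * size S) ^ 2 = 2592 * size S ^ 4)%N by ring.
Qed.

Local Open Scope nat_scope.

(** * Combining the exponents *)

(** The letters stand for: [n], [al] the sizes of the set and of its subset,
    [p], [x] the numbers of popular differences and ratios, [t], [s], [k] the
    three dyadic levels, [SP], [SC] the two line energies, [E], [M] the additive
    and multiplicative energies, [J] the number of dyadic levels, and [c] the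
    constant of the rich lines bound.  The base [w] of the dyadic decomposition is
    kept symbolic so that constants appear as its powers.

    When [SP] obeys the second bound, the powers of [x] in the Cauchy-Schwarz
    inequality leave a bound on [x * k ^ 2], and [M * E ^ 3] is at most a multiple
    of [x * k ^ 2 * p * t ^ 4] times [(p * t) ^ 2].  When it obeys the first one, a
    bound on [x * k ^ 4] is obtained instead; the cube of [M * E ^ 3] brings in
    [x ^ 3 * k ^ 6], which is this quantity times [(x * k) ^ 2]. *)
Lemma energy_product_arith (w J c n al E M p t s x k SP SC : nat) :
  0 < J -> 0 < c -> 0 < w ->
  E <= J * (w ^ 2 * t ^ 2 * p) -> p * t <= J * (w * s * al) ->
  M <= J * (w ^ 2 * k ^ 2 * x) -> x * k <= al ^ 2 ->
  (x * k * s ^ 2) ^ 2 <= SP * SC ->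
  x <= n ^ 2 -> p * t <= n ^ 2 -> p * t ^ 2 <= n ^ 3 ->
  SP <= w ^ 2 * J * x * p ^ 2 \/ SP ^ 2 <= w ^ 4 * J ^ 2 * c * x * p ^ 6 ->
  SC <= w ^ 2 * J * x * n ^ 2 \/ SC ^ 2 <= w ^ 4 * J ^ 2 * c * x * n ^ 6 ->
  M * E ^ 3 <= w ^ 16 * c * J ^ 10 * n ^ 7 * al ^ 4.
Proof.
move=> J_gt0 c_gt0 w_gt0 hE hpt hM hxk hT xn ptn ptn3 hSP hSC.
have [p0|p_gt0] := posnP p.
  by move: hE; rewrite p0 !muln0 leqn0 => /eqP->; rewrite muln0.
have [x0|x_gt0] := posnP x.
  by move: hM; rewrite x0 !muln0 leqn0 => /eqP->.
have hSC' : SC ^ 2 <= w ^ 4 * J ^ 2 * c * x * n ^ 6.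
  case: hSC => // h; apply: (@leq_trans ((w ^ 2 * J * x * n ^ 2) ^ 2)).
    by rewrite leq_exp2r.
  have -> : (w ^ 2 * J * x * n ^ 2) ^ 2 = w ^ 4 * J ^ 2 * 1 * x * n ^ 4 * x by ring.
  have -> : w ^ 4 * J ^ 2 * c * x * n ^ 6 = w ^ 4 * J ^ 2 * c * x * n ^ 4 * n ^ 2 by ring.
  by rewrite !leq_mul.
have hT2 : (x * k * s ^ 2) ^ 4 <= SP ^ 2 * SC ^ 2.
  by rewrite -expnMn (expnM _ 2 2) leq_exp2r.
have hME : M * E ^ 3 <= w ^ 8 * J ^ 4 * k ^ 2 * x * p ^ 3 * t ^ 6.
  apply: leq_trans (leq_mul hM (_ : _ <= (J * (w ^ 2 * t ^ 2 * p)) ^ 3)) _.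
    by rewrite leq_exp2r.
  by apply: eq_leq; ring.
case: hSP => hP; last first.
  have h1 : (x * k ^ 2 * s ^ 4) ^ 2 <= (w ^ 4 * J ^ 2 * c * n ^ 3 * p ^ 3) ^ 2.
    rewrite -(@leq_pmul2r (x ^ 2)) ?expn_gt0 ?x_gt0 //.
    have -> : (x * k ^ 2 * s ^ 4) ^ 2 * x ^ 2 = (x * k * s ^ 2) ^ 4 by ring.
    apply: leq_trans hT2 _; apply: leq_trans (leq_mul hP hSC') _.
    by apply: eq_leq; ring.
  rewrite leq_exp2r // in h1.
  have h2 : x * k ^ 2 * p * t ^ 4 <= w ^ 8 * J ^ 6 * c * n ^ 3 * al ^ 4.
    rewrite -(@leq_pmul2r (p ^ 3)) ?expn_gt0 ?p_gt0 //.
    have -> : x * k ^ 2 * p * t ^ 4 * p ^ 3 = x * k ^ 2 * (p * t) ^ 4 by ring.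
    apply: (@leq_trans (x * k ^ 2 * (J * (w * s * al)) ^ 4)).
      by rewrite leq_mul // leq_exp2r.
    have -> : x * k ^ 2 * (J * (w * s * al)) ^ 4
      = w ^ 4 * J ^ 4 * al ^ 4 * (x * k ^ 2 * s ^ 4) by ring.
    by apply: leq_trans (leq_mul (leqnn _) h1) _; apply: eq_leq; ring.
  apply: leq_trans hME _.
  have -> : w ^ 8 * J ^ 4 * k ^ 2 * x * p ^ 3 * t ^ 6
    = w ^ 8 * J ^ 4 * ((x * k ^ 2 * p * t ^ 4) * (p * t) ^ 2) by ring.
  have pt2 : (p * t) ^ 2 <= (n ^ 2) ^ 2 by rewrite leq_exp2r.
  apply: leq_trans (leq_mul (leqnn _) (leq_mul h2 pt2)) _.
  by apply: eq_leq; ring.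
have h1 : x * k ^ 4 * s ^ 8 <= w ^ 8 * J ^ 4 * c * p ^ 4 * n ^ 6.
  rewrite -(@leq_pmul2r (x ^ 3)) ?expn_gt0 ?x_gt0 //.
  have -> : x * k ^ 4 * s ^ 8 * x ^ 3 = (x * k * s ^ 2) ^ 4 by ring.
  apply: leq_trans hT2 _.
  have hP2 : SP ^ 2 <= (w ^ 2 * J * x * p ^ 2) ^ 2 by rewrite leq_exp2r.
  by apply: leq_trans (leq_mul hP2 hSC') _; apply: eq_leq; ring.
have h2 : x * k ^ 4 * p ^ 4 * t ^ 8 <= w ^ 16 * J ^ 12 * c * n ^ 6 * al ^ 8.
  rewrite -(@leq_pmul2r (p ^ 4)) ?expn_gt0 ?p_gt0 //.
  have -> : x * k ^ 4 * p ^ 4 * t ^ 8 * p ^ 4 = x * k ^ 4 * (p * t) ^ 8 by ring.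
  apply: (@leq_trans (x * k ^ 4 * (J * (w * s * al)) ^ 8)).
    by rewrite leq_mul // leq_exp2r.
  have -> : x * k ^ 4 * (J * (w * s * al)) ^ 8
    = w ^ 8 * J ^ 8 * al ^ 8 * (x * k ^ 4 * s ^ 8) by ring.
  by apply: leq_trans (leq_mul (leqnn _) h1) _; apply: eq_leq; ring.
have h3 : x ^ 3 * k ^ 6 * p ^ 4 * t ^ 8 <= w ^ 16 * J ^ 12 * c * n ^ 6 * al ^ 12.
  have hxk2 : (x * k) ^ 2 <= (al ^ 2) ^ 2 by rewrite leq_exp2r.
  have -> : x ^ 3 * k ^ 6 * p ^ 4 * t ^ 8 = x * k ^ 4 * p ^ 4 * t ^ 8 * (x * k) ^ 2 by ring.
  by apply: leq_trans (leq_mul h2 hxk2) _; apply: eq_leq; ring.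
rewrite -(@leq_exp2r _ _ 3) //.
apply: (@leq_trans ((w ^ 8 * J ^ 4 * k ^ 2 * x * p ^ 3 * t ^ 6) ^ 3)).
  by rewrite leq_exp2r.
have -> : (w ^ 8 * J ^ 4 * k ^ 2 * x * p ^ 3 * t ^ 6) ^ 3
  = w ^ 24 * J ^ 12 * ((x ^ 3 * k ^ 6 * p ^ 4 * t ^ 8) * (p * t ^ 2) ^ 5) by ring.
have pt5 : (p * t ^ 2) ^ 5 <= (n ^ 3) ^ 5 by rewrite leq_exp2r.
apply: leq_trans (leq_mul (leqnn _) (leq_mul h3 pt5)) _.
have -> : w ^ 24 * J ^ 12 * (w ^ 16 * J ^ 12 * c * n ^ 6 * al ^ 12 * (n ^ 3) ^ 5)
  = w ^ 40 * J ^ 24 * c * (n ^ 21 * al ^ 12) * 1 by ring.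
have -> : (w ^ 16 * c * J ^ 10 * n ^ 7 * al ^ 4) ^ 3
  = w ^ 40 * J ^ 24 * c * (n ^ 21 * al ^ 12) * (w ^ 8 * J ^ 6 * c ^ 2) by ring.
rewrite leq_mul2l; apply/orP; right.
by rewrite !muln_gt0 w_gt0 J_gt0 c_gt0.
Qed.

(** * Additive energy along a set of slopes *)

(** The slope and intercept of the line of slope [t.1] through the point with
    abscissa [t.2.2] and ordinate [t.2.1]. *)
Definition line_through (K : nzRingType) (t : K * (K * K)) : K * K :=
  (t.1, t.2.1 - t.1 * t.2.2)%R.

Definition line_energy (K : nzRingType) (X S : seq K) : nat :=
  collisions (pairs X (pairs S S)) (pairs X (pairs S S)) (@line_through K) (@line_through K).

(** An abscissa on a given line determines the ordinate. *)
Lemma fiber_size_line_through (K : nzRingType) (X S : seq K) (l : K * K) :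
  uniq X -> uniq S ->
  fiber_size (pairs X (pairs S S)) (@line_through K) l <= size (rich_pts S l).
Proof.
case: l => x e uX uS; rewrite /fiber_size big_pairs size_filter_sum.
apply: leq_trans (sum_indicator_le x (fun=> \sum_(s <- S) (x * s + e \in S)%R) uX).
apply: leq_sum => x1 _; rewrite big_pairs eq_sym.
have [->|xx1] := eqVneq x1 x; last first.
  rewrite mul0n big1 // => p _; rewrite big1 // => p' _.
  by rewrite /line_through xpair_eqE (negPf xx1).
rewrite mul1n exchange_big /=; apply: leq_sum => s _.
apply: leq_trans (_ : \sum_(p <- S) ((x * s + e)%R == p) * 1 <= _).
  apply: leq_sum => p _; rewrite /line_through /= xpair_eqE eqxx /= muln1.
  by rewrite subr_eq addrC eq_sym.
have [xS|xS] := boolP (_ \in S); first exact: (sum_indicator_le _ (fun=> 1)).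
rewrite big_seq big1 // => p pS; case: eqP => // xp.
by move: xS; rewrite xp pS.
Qed.

Lemma mem_line_through (K : nzRingType) (X S : seq K) (l : K * K) :
  l \in map (@line_through K) (pairs X (pairs S S)) -> l.1 \in X.
Proof. by move=> /mapP[t]; rewrite mem_pairs => /andP[tX _] ->. Qed.

(** At the dominant richness [k] there are [N] lines, with [k * N] at most
    [size X * size S ^ 2], the number of triples, and [k ^ 3 * N] at most
    [c * size S ^ 4].  The product of the two bounds controls [(k ^ 2 * N) ^ 2].
    The rich lines bound says nothing at [k = 1], whence the first alternative. *)
Lemma line_energy_bound (K : fieldType) c (X S : seq K) J :
  rich_lines_bound K c -> uniq X -> 0%R \notin X -> uniq S ->
  0 < J -> size S < 2 ^ J ->
  line_energy X S <= 2 ^ 2 * J * size X * size S ^ 2 \/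
  line_energy X S ^ 2 <= 2 ^ 4 * J ^ 2 * c * size X * size S ^ 6.
Proof.
move=> rich uX X0 uS J0 SJ.
rewrite /line_energy collisions_self_fiber_size; set Z := undup _; set r := fiber_size _ _.
have uZ : uniq Z by apply: undup_uniq.
have rS l : r l <= size (rich_pts S l) by apply: fiber_size_line_through.
have sumr : \sum_(l <- Z) r l = size X * size S ^ 2.
  rewrite sum_fiber_size //; first by rewrite !size_pairs.
  by move=> t tX; rewrite mem_undup map_f.
have [|k k0 Hk] := @dyadic_pigeonhole _ Z r 2 J J0 isT.
  move=> l _; apply: leq_ltn_trans (rS l) (leq_ltn_trans _ SJ).
  by rewrite size_filter count_size.
set L := filter _ _ in Hk.
have kL : k * size L <= size X * size S ^ 2.
  by rewrite -sumr; have := sum_nat_filter_ge Z r 1 k; rewrite expn1.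
have [k1|k1] := leqP k 1.
  have {}k1 : k = 1 by apply/eqP; rewrite eqn_leq k1.
  left; apply: leq_trans Hk _; rewrite k1 mul1n in kL *.
  apply: (@leq_trans (J * (2 ^ 2 * (size X * size S ^ 2)))).
    by rewrite leq_mul2l exp1n muln1 leq_mul2l kL !orbT.
  by apply: eq_leq; ring.
right.
have Lk : size L * k ^ 3 <= c * size S ^ 4.
  apply: rich => // [|l]; first exact: filter_uniq.
  rewrite mem_filter mem_undup => /andP[kl /mem_line_through lX].
  by split; [apply: contraNneq X0 => <- | apply: leq_trans kl _].
apply: (@leq_trans ((J * (2 ^ 2 * k ^ 2 * size L)) ^ 2)); first by rewrite leq_exp2r.
have -> : (J * (2 ^ 2 * k ^ 2 * size L)) ^ 2
  = 2 ^ 4 * J ^ 2 * ((k * size L) * (size L * k ^ 3)) by ring.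
apply: leq_trans (leq_mul (leqnn _) (leq_mul kL Lk)) _.
by apply: eq_leq; ring.
Qed.

(** * A subset of small multiplicative energy *)

Definition sub_energy (K : zmodType) (S : seq K) : nat :=
  collisions (pairs S S) (pairs S S) (fun p => p.1 - p.2)%R (fun p => p.1 - p.2)%R.

Definition div_energy (K : fieldType) (S : seq K) : nat :=
  collisions (pairs S S) (pairs S S) (fun p => p.1 / p.2)%R (fun p => p.1 / p.2)%R.

Lemma fiber_size_sub (K : zmodType) (S : seq K) d : uniq S ->
  fiber_size (pairs S S) (fun p => p.1 - p.2)%R d = \sum_(a <- S) (a - d \in S)%R.
Proof.
move=> uS; rewrite /fiber_size big_pairs; apply: eq_bigr => a _ /=.
have E b : (a - b == d)%R = (a - d == b)%R.
  by rewrite !subr_eq addrC.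
under eq_bigr do rewrite E -[X in nat_of_bool X]andbT -mulnb.
have [aS|aS] := boolP (_ \in S); first by rewrite (sum_indicator (fun=> 1)).
rewrite big_seq big1 // => b bS; case: eqP => // ab.
by move: aS; rewrite ab bS.
Qed.

Lemma sum_fiber_size_le (I : Type) (T : eqType) (rI : seq I) (f : I -> T) (B : seq T)
  (G : T -> nat) :
  uniq B -> \sum_(b <- B) fiber_size rI f b * G b <= \sum_(i <- rI) G (f i).
Proof.
move=> uB; under eq_bigr do rewrite big_distrl.
rewrite exchange_big /=; apply: leq_sum => i _; exact: sum_indicator_le.
Qed.

(** For each of the [k] ways of writing [x = a / b] there are [s] ways of writing
    [a = c + p] and [s] of writing [b = c' + p'], and then
    [p - x * p' = - (c - x * c')]. *)
Lemma rich_quotients_le_collisions (K : fieldType) (C P A X : seq K) k s :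
  uniq C -> uniq A -> uniq X -> 0%R \notin A ->
  {in A, forall a, s <= \sum_(p <- P) (a - p \in C)%R} ->
  {in X, forall x, k <= fiber_size (pairs A A) (fun p => p.1 / p.2)%R x} ->
  size X * k * s ^ 2 <=
    collisions (pairs X (pairs P P)) (pairs X (pairs C C)) (@line_through K)
      (fun t => (t.1, - (t.2.1 - t.1 * t.2.2))%R).
Proof.
move=> uC uA uX A0 As Xk.
pose sum2 (p : K * K) := (p.1 + p.2)%R; pose w := fiber_size (pairs P C) sum2.
have sw a : a \in A -> s <= w a.
  move=> /As/leq_trans; apply; rewrite /w /fiber_size big_pairs; apply: leq_sum => p _.
  have [aC|//] := boolP (_ \in C).
  by rewrite (bigD1_seq (a - p)%R) //= /sum2 /= addrC subrK eqxx.
have one x : x \in X -> k * s ^ 2 <=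
    collisions (pairs P C) (pairs P C) sum2 (fun p => x * sum2 p)%R.
  move=> xX; apply: (@leq_trans (\sum_(a <- A) w a * \sum_(b <- A) w b * (a == x * b)%R)).
    apply: leq_trans (leq_mul (Xk x xX) (leqnn _)) _.
    rewrite /fiber_size big_pairs big_distrl !big_seq; apply: leq_sum => a aA /=.
    rewrite big_distrl big_distrr !big_seq; apply: leq_sum => b bA /=.
    have -> : (a / b == x)%R = (a == x * b)%R.
      rewrite -(inj_eq (mulIf (_ : b != 0)%R)) ?divfK //;
      by apply: contraNneq A0 => <-.
    by rewrite mulnA mulnC leq_mul2r -mulnn leq_mul ?orbT ?sw.
  apply: leq_trans (sum_fiber_size_le _ _ (fun a => \sum_(b <- A) w b * (a == x * b)%R) uA) _.
  apply: leq_sum => i _; exact: sum_fiber_size_le (fun b => (sum2 i == x * b)%R : nat) uA.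
rewrite /collisions big_pairs -mulnA -sum1_size big_distrl !big_seq /=.
apply: leq_sum => x xX; rewrite mul1n; apply: leq_trans (one x xX) _.
rewrite /collisions !big_pairs; apply: leq_sum => p _.
under eq_bigr do rewrite big_pairs; rewrite exchange_big /=; apply: leq_sum => p' _.
rewrite big_pairs [leqRHS](bigD1_seq x) //=; apply: leq_trans (leq_addr _ _).
rewrite big_pairs; apply: leq_sum => c _; apply: leq_sum => c' _.
rewrite /line_through /= xpair_eqE eqxx /= -subr_eq0 -[in leqRHS]subr_eq0 /sum2 /=.
by apply: eq_leq; congr (nat_of_bool (_ == _)); ring.
Qed.

Lemma collisions_line_through_opp (K : nzRingType) (C X : seq K) :
  collisions (pairs X (pairs C C)) (pairs X (pairs C C))
    (fun t => (t.1, - (t.2.1 - t.1 * t.2.2))%R)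
    (fun t => (t.1, - (t.2.1 - t.1 * t.2.2))%R) = line_energy X C.
Proof.
apply: eq_bigr => t _; apply: eq_bigr => t' _.
by rewrite /line_through !xpair_eqE eqr_opp.
Qed.

(** [B] consists of the elements that have many representations as an element of
    [C] plus a popular difference of [C].  The power [size B ^ 4] matters: it is
    what makes the bound stable under disjoint unions. *)
Lemma energy_tradeoff (K : fieldType) c :
  rich_lines_bound K c -> 0 < c ->
  exists M, forall (C : seq K) J,
    uniq C -> 0%R \notin C -> 0 < size C -> 0 < J -> size C ^ 2 < 2 ^ J ->
    exists B : seq K, [/\ subseq B C, 0 < size B &
      div_energy B * sub_energy C ^ 3 <= M * J ^ 10 * size C ^ 7 * size B ^ 4].
Proof.
move=> rich c0; exists (2 ^ 16 * c) => C J uC C0 sC J0 CJ; set n := size C in sC CJ *.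
have nn2 : n <= n ^ 2 by rewrite -mulnn leq_pmulr.
pose r := fiber_size (pairs C C) (fun p => p.1 - p.2)%R.
pose D := undup (map (fun p => p.1 - p.2)%R (pairs C C)).
have uD : uniq D by apply: undup_uniq.
have [|t t0 hE] := @dyadic_pigeonhole _ D r 2 J J0 isT.
  move=> d _; apply: leq_ltn_trans CJ; apply: leq_trans (fiber_size_le_size _ _ _) _.
  by rewrite size_pairs mulnn.
rewrite /r /D -collisions_self_fiber_size -/r -/D -/(sub_energy C) in hE.
set P := filter _ D in hE.
have uP : uniq P by apply: filter_uniq.
have sumr : \sum_(d <- D) r d = n ^ 2.
  rewrite sum_fiber_size //; first by rewrite size_pairs mulnn.
  by move=> p pC; rewrite mem_undup; apply/mapP; exists p.
have rn d : r d <= n.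
  rewrite /r fiber_size_sub // /n -sum1_size; apply: leq_sum => a _; by case: (_ \in _).
have tP : t * size P <= n ^ 2.
  by rewrite -sumr; have := sum_nat_filter_ge D r 1 t; rewrite expn1.
have Pn : size P <= n ^ 2.
  by apply: leq_trans tP; rewrite leq_pmull.
pose w a := \sum_(p <- P) (a - p \in C)%R.
have wP a : w a <= size P.
  by rewrite -sum1_size; apply: leq_sum => p _; case: (_ \in _).
have [|s s0 hA] := @dyadic_pigeonhole _ C w 1 J J0 isT.
  by move=> a _; apply: leq_ltn_trans CJ; apply: leq_trans (wP a) Pn.
(* The set B of the statement: elements with many popular differences *)
set A := filter _ C in hA.
have uA : uniq A by apply: filter_uniq.
have A0 : 0%R \notin A by rewrite mem_filter (negPf C0) andbF.
have hpt : size P * t <= J * (2 * s * size A).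
  apply: leq_trans hA; under eq_bigr do rewrite expn1.
  rewrite exchange_big /= -sum1_size big_distrl !big_seq /=.
  apply: leq_sum => p; rewrite mem_filter mul1n => /andP[tp _].
  by apply: leq_trans tp _; rewrite /r fiber_size_sub.
have E0 : 0 < sub_energy C.
  by apply: leq_trans (collisions_self_ge _ _); rewrite size_pairs muln_gt0 sC.
have P0 : 0 < size P.
  by rewrite lt0n; apply/eqP => P0; move: hE E0; rewrite P0 !muln0 leqn0 => /eqP->.
have sA0 : 0 < size A.
  have Pt0 : 0 < size P * t by rewrite muln_gt0 P0.
  rewrite lt0n; apply/eqP => sA; move: (leq_trans Pt0 hpt).
  by rewrite sA !muln0.
exists A; split; [exact: filter_subseq | exact: sA0 | ].
pose q := fiber_size (pairs A A) (fun p => p.1 / p.2)%R.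
pose Q := undup (map (fun p => p.1 / p.2)%R (pairs A A)).
have uQ : uniq Q by apply: undup_uniq.
have sAn : size A <= n by rewrite size_filter count_size.
have sA2 : size A ^ 2 <= n ^ 2 by rewrite leq_exp2r.
have [|k k0 hM] := @dyadic_pigeonhole _ Q q 2 J J0 isT.
  move=> d _; apply: leq_ltn_trans CJ; apply: leq_trans (fiber_size_le_size _ _ _) _.
  by rewrite size_pairs mulnn.
rewrite /q /Q -collisions_self_fiber_size -/q -/Q -/(div_energy A) in hM.
set X := filter _ Q in hM.
have uX : uniq X by apply: filter_uniq.
have X0 : 0%R \notin X.
  rewrite mem_filter mem_undup negb_and; apply/orP; right.
  apply/mapP => -[[a b]]; rewrite mem_pairs /= => /andP[aA bA] /esym/eqP.
  by rewrite mulf_eq0 invr_eq0 => /orP[]/eqP ab; move: A0; rewrite -ab ?aA ?bA.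
have sumq : \sum_(d <- Q) q d = size A ^ 2.
  rewrite sum_fiber_size //; first by rewrite size_pairs mulnn.
  by move=> p pC; rewrite mem_undup; apply/mapP; exists p.
have hxk : size X * k <= size A ^ 2.
  by rewrite -sumq mulnC; have := sum_nat_filter_ge Q q 1 k; rewrite expn1.
have Xn : size X <= n ^ 2.
  by apply: leq_trans sA2; apply: leq_trans hxk; rewrite leq_pmulr.
have hT : (size X * k * s ^ 2) ^ 2 <= line_energy X P * line_energy X C.
  have h : size X * k * s ^ 2 <= collisions (pairs X (pairs P P)) (pairs X (pairs C C))
      (@line_through K) (fun t => (t.1, - (t.2.1 - t.1 * t.2.2))%R).
    apply: (@rich_quotients_le_collisions K C P A) => // z; rewrite mem_filter; by case/andP.
  rewrite -[line_energy X C]collisions_line_through_opp.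
  apply: leq_trans (collisions_cauchy_schwarz _ _ _ _).
  by rewrite leq_exp2r //; exact: h.
apply: (@energy_product_arith 2 J c n (size A) _ _ (size P) t s (size X) k _ _
          J0 c0 isT hE hpt hM hxk hT Xn).
- by rewrite mulnC.
- have tn : t <= n.
    case eP : P P0 => [//|p P'] _; have : p \in P by rewrite eP mem_head.
    by rewrite mem_filter => /andP[tp _]; apply: leq_trans tp (rn p).
  by rewrite -mulnn mulnA [size P * t]mulnC expnSr leq_mul.
- apply: line_energy_bound => //; exact: leq_ltn_trans Pn CJ.
- apply: line_energy_bound => //; exact: leq_ltn_trans nn2 CJ.
Qed.

(** * Multiplicative energy of a union *)

Lemma collisions_sym (I J : Type) (T : eqType) (rI : seq I) (rJ : seq J) (f : I -> T) (g : J -> T) :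
  collisions rI rJ f g = collisions rJ rI g f.
Proof.
rewrite /collisions exchange_big; apply: eq_bigr => i _; apply: eq_bigr => j _.
by rewrite eq_sym.
Qed.

Definition prod_collisions (K : nzRingType) (A B C D : seq K) : nat :=
  collisions (pairs A B) (pairs C D) (fun p => p.1 * p.2)%R (fun p => p.1 * p.2)%R.

(** Ratios suit the incidence argument, and products the bound for a union, where
    commutativity merges the two mixed terms. *)
Lemma prod_collisions_div (K : fieldType) (A B C D : seq K) :
  0%R \notin B -> 0%R \notin C ->
  prod_collisions A B C D =
  collisions (pairs A C) (pairs D B) (fun p => p.1 / p.2)%R (fun p => p.1 / p.2)%R.
Proof.
move=> B0 C0; rewrite /prod_collisions /collisions !big_pairs; apply: eq_bigr => a _.
under eq_bigr do rewrite big_pairs; under [RHS]eq_bigr do rewrite big_pairs.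
rewrite exchange_big !big_seq; apply: eq_bigr => c cC /=.
rewrite exchange_big; apply: eq_bigr => d _ /=; rewrite !big_seq; apply: eq_bigr => b bB.
have b0 : (b != 0)%R by apply: contraNneq B0 => <-.
have c0 : (c != 0)%R by apply: contraNneq C0 => <-.
by rewrite eqr_div // [(d * c)%R]mulrC.
Qed.

(** This takes a square root in the first hypothesis without leaving the natural
    numbers. *)
Lemma sqr_leq_mul_scaled x y z F D u v :
  x ^ 2 <= y * z -> y * F <= D * u ^ 2 -> z * F <= D * v ^ 2 -> x * F <= D * (u * v).
Proof.
move=> xyz hy hz; rewrite -(@leq_exp2r _ _ 2) // expnMn.
apply: leq_trans (leq_mul xyz (leqnn _)) _.
have -> : y * z * F ^ 2 = (y * F) * (z * F) by ring.
by apply: leq_trans (leq_mul hy hz) _; apply: eq_leq; ring.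
Qed.

Lemma prod_collisions_cat (K : fieldType) (A B C D : seq K) :
  prod_collisions (A ++ B) (A ++ B) C D =
  prod_collisions A A C D + 2 * prod_collisions A B C D + prod_collisions B B C D.
Proof.
have swap : prod_collisions B A C D = prod_collisions A B C D.
  rewrite /prod_collisions /collisions !big_pairs exchange_big; apply: eq_bigr => a _.
  by apply: eq_bigr => b _; rewrite /= mulrC.
have split4 : prod_collisions (A ++ B) (A ++ B) C D
    = prod_collisions A A C D + prod_collisions A B C D
    + (prod_collisions B A C D + prod_collisions B B C D).
  rewrite /prod_collisions /collisions !big_pairs big_cat /=; congr addn.
    by rewrite -big_split; apply: eq_bigr => a _; rewrite big_cat.
  by rewrite -big_split; apply: eq_bigr => a _; rewrite big_cat.
by rewrite split4 swap; ring.
Qed.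

(** The fourth root of the multiplicative energy is subadditive.  The number of
    representations of a product over the union is that over [A * A], plus twice
    that over [A * B], plus that over [B * B]; after division by [D / F] their
    norms are at most [a ^ 2], [a * b] and [b ^ 2], where the middle one uses
    that [x * y = x' * y'] amounts to [x / x' = y' / y].  Thus the total norm is
    at most [(a + b) ^ 2]. *)
Lemma div_energy_cat (K : fieldType) (A B : seq K) F D :
  0%R \notin A -> 0%R \notin B ->
  div_energy A * F <= D * size A ^ 4 -> div_energy B * F <= D * size B ^ 4 ->
  div_energy (A ++ B) * F <= D * (size A + size B) ^ 4.
Proof.
move=> A0 B0; set a := size A; set b := size B.
have AB0 : 0%R \notin A ++ B by rewrite mem_cat negb_or A0.
rewrite /div_energy -!prod_collisions_div // => hA hB.
have CS (X Y Z W : seq K) :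
    prod_collisions X Y Z W ^ 2 <= prod_collisions X Y X Y * prod_collisions Z W Z W.
  exact: collisions_cauchy_schwarz.
have hAB : prod_collisions A B A B * F <= D * (a * b) ^ 2.
  rewrite expnMn.
  apply: (@sqr_leq_mul_scaled _ (prod_collisions A A A A) (prod_collisions B B B B)).
  - rewrite (prod_collisions_div A B B0 A0) (prod_collisions_div A A A0 A0).
    rewrite (prod_collisions_div B B B0 B0).
    exact: collisions_cauchy_schwarz.
  - by rewrite -[(a ^ 2) ^ 2]expnM.
  - by rewrite -[(b ^ 2) ^ 2]expnM.
have hA' : prod_collisions A A A A * F <= D * (a ^ 2) ^ 2 by rewrite -expnM.
have hB' : prod_collisions B B B B * F <= D * (b ^ 2) ^ 2 by rewrite -expnM.
have sC (X Y Z W : seq K) : prod_collisions X Y Z W = prod_collisions Z W X Y.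
  exact: collisions_sym.
have lin x y z : (x + 2 * y + z) * F = x * F + 2 * (y * F) + z * F by ring.
have row (X Y : seq K) u : prod_collisions X Y X Y * F <= D * u ^ 2 ->
    prod_collisions (A ++ B) (A ++ B) X Y * F <= D * ((a + b) ^ 2 * u).
  move=> hX; rewrite prod_collisions_cat.
  have h1 := sqr_leq_mul_scaled (CS A A X Y) hA' hX.
  have h2 := sqr_leq_mul_scaled (CS A B X Y) hAB hX.
  have h3 := sqr_leq_mul_scaled (CS B B X Y) hB' hX.
  rewrite lin; apply: leq_trans (leq_add (leq_add h1 (leq_mul (leqnn 2) h2)) h3) _.
  by apply: eq_leq; ring.
rewrite prod_collisions_cat ![prod_collisions _ _ (A ++ B) _]sC lin.
have h12 := leq_add (row _ _ _ hA') (leq_mul (leqnn 2) (row _ _ _ hAB)).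
apply: leq_trans (leq_add h12 (row _ _ _ hB')) _.
by apply: eq_leq; ring.
Qed.

(** * Energies of finite sets *)

Local Open Scope fset_scope.

(** The enumeration [s] is arbitrary because a union of sets is best enumerated
    by concatenation, which is not its canonical enumeration. *)
Lemma card_quadruples (K : choiceType) (X : {fset K}) (s : seq K) (P : K -> K -> K -> K -> bool) :
  uniq s -> s =i X ->
  #|` [fset q in X `*` X `*` X `*` X | let: (x1, x2, x3, x4) := q in P x1 x2 x3 x4] |
  = \sum_(x1 <- s) \sum_(x2 <- s) \sum_(x3 <- s) \sum_(x4 <- s) P x1 x2 x3 x4.
Proof.
move=> us sX; set F := [fset q in _ | _].
pose p (q : K * K * K * K) := let: (x1, x2, x3, x4) := q in P x1 x2 x3 x4.
have /perm_size -> : perm_eq F [seq q <- pairs (pairs (pairs s s) s) s | p q].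
  apply: uniq_perm => [||q]; first exact: fset_uniq.
    by rewrite filter_uniq // !uniq_pairs.
  rewrite !inE mem_filter !mem_pairs !sX andbC.
  by case: q => [[[x1 x2] x3] x4].
by rewrite size_filter_sum !big_pairs.
Qed.

Lemma add_energyE (K : zmodType) (X : {fset K}) (s : seq K) :
  uniq s -> s =i X -> add_energy X = sub_energy s.
Proof.
move=> us sX; rewrite /add_energy (card_quadruples (fun x1 x2 x3 x4 => x1 + x3 == x2 + x4)%R us sX).
rewrite /sub_energy /collisions big_pairs; apply: eq_bigr => a _; apply: eq_bigr => b _.
rewrite big_pairs exchange_big /=; apply: eq_bigr => c _; apply: eq_bigr => d _.
congr nat_of_bool; by rewrite subr_eq addrAC [RHS]eq_sym subr_eq [RHS]eq_sym [(c + b)%R]addrC.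
Qed.

Lemma mul_energyE (K : fieldType) (X : {fset K}) (s : seq K) :
  0%R \notin X -> uniq s -> s =i X -> mul_energy X = div_energy s.
Proof.
move=> X0 us sX; have s0 : 0%R \notin s by rewrite sX.
rewrite /mul_energy (card_quadruples (fun x1 x2 x3 x4 => x1 * x3 == x2 * x4)%R us sX).
rewrite /div_energy -prod_collisions_div // /prod_collisions /collisions big_pairs.
apply: eq_bigr => a _; rewrite exchange_big; apply: eq_bigr => b _ /=.
by rewrite big_pairs.
Qed.

Lemma add_energy_mono (K : zmodType) (X Y : {fset K}) :
  X `<=` Y -> add_energy X <= add_energy Y.
Proof.
move=> /fsubsetP XY; apply: fsubset_leq_card; apply/fsubsetP => q.
by rewrite !inE => /andP[/andP[/andP[/andP[h1 h2] h3] h4] ->]; rewrite !XY.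
Qed.

Lemma mul_energy_mono (K : nzRingType) (X Y : {fset K}) :
  X `<=` Y -> mul_energy X <= mul_energy Y.
Proof.
move=> /fsubsetP XY; apply: fsubset_leq_card; apply/fsubsetP => q.
by rewrite !inE => /andP[/andP[/andP[/andP[h1 h2] h3] h4] ->]; rewrite !XY.
Qed.

Lemma mul_energy_disjointU (K : fieldType) (A B : {fset K}) F D :
  0%R \notin A -> 0%R \notin B -> [disjoint A & B] ->
  mul_energy A * F <= D * #|` A| ^ 4 -> mul_energy B * F <= D * #|` B| ^ 4 ->
  mul_energy (A `|` B) * F <= D * #|` A `|` B| ^ 4.
Proof.
move=> A0 B0 dAB; rewrite (mul_energyE A0 (fset_uniq A)) // (mul_energyE B0 (fset_uniq B)) //.
have uAB : uniq (A ++ B :> seq K).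
  rewrite cat_uniq !fset_uniq andbT /=; apply/hasPn => b bB.
  by apply/negP => bA; move: (fdisjointP dAB _ bA); rewrite bB.
have eAB : (A ++ B :> seq K) =i A `|` B by move=> x; rewrite mem_cat inE.
rewrite (mul_energyE _ uAB eAB); last by rewrite inE negb_or A0.
rewrite cardfsU (eqP dAB) cardfs0 subn0; exact: div_energy_cat.
Qed.

(** * The greedy decomposition *)

(** Subsets are moved one after the other from [A `\` B] to [B].  The last one
    may overshoot the size [m]; it is then truncated, which by monotonicity only
    costs the replacement of the fourth power of the size of [B] by that of
    [A]. *)
Lemma balanced_split (K : fieldType) c :
  rich_lines_bound K c -> 0 < c ->
  exists M, forall (A : {fset K}) J m,
    0%R \notin A -> 0 < J -> #|` A| ^ 2 < 2 ^ J -> 0 < m <= #|` A| ->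
    exists B, [/\ B `<=` A, #|` B| = m &
      mul_energy B * add_energy (A `\` B) ^ 3 <= M * J ^ 10 * #|` A| ^ 11].
Proof.
move=> rich c0; have [M HM] := energy_tradeoff rich c0; exists M => A J m A0 J0 AJ /andP[m0 mA].
set n := #|` A| in AJ mA *; pose D := M * J ^ 10 * n ^ 7.
have sub0 (X : {fset K}) : X `<=` A -> 0%R \notin X.
  by move=> /fsubsetP XA; apply: contra A0 => /XA.
set goal := exists B, _.
(* Either some B of size exactly m is found, or k moves have been made *)
have step k : goal \/ exists B, [/\ B `<=` A, k <= #|` B| < m &
    mul_energy B * add_energy (A `\` B) ^ 3 <= D * #|` B| ^ 4].
  elim: k => [|k [|[B [BA /andP[kB Bm] hB]]]]; [right | by left | ].
    exists fset0; split; [exact: fsub0set | by rewrite cardfs0 | ].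
    have /eqP -> : mul_energy (fset0 : {fset K}) == 0.
      by rewrite cardfs_eq0; apply/eqP/fsetP => q; rewrite !inE /=.
    by rewrite mul0n.
  set C := A `\` B in hB *.
  have CA : C `<=` A by exact: fsubsetDl.
  have sC : #|` C| = n - #|` B| by rewrite cardfsDS.
  have [|||s [sC' s0 hs]] := HM C J (fset_uniq C) (sub0 _ CA).
  - by rewrite sC subn_gt0; apply: leq_trans mA.
  - exact: J0.
  - by apply: leq_ltn_trans AJ; rewrite leq_exp2r // fsubset_leq_card.
  have us : uniq s by apply: subseq_uniq sC' (fset_uniq C).
  pose B' := [fset x in s].
  have sB' : s =i B' by move=> x; rewrite inE.
  have cB' : #|` B'| = size s by rewrite card_fseq undup_id.
  have B'C : B' `<=` C by apply/fsubsetP => x; rewrite -sB' => /(mem_subseq sC').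
  have B'A := fsubset_trans B'C CA.
  have dBB' : [disjoint B & B'].
    apply/fdisjointP => x xB; apply/negP => /(fsubsetP B'C); by rewrite inE xB.
  have hB' : mul_energy B' * add_energy C ^ 3 <= D * #|` B'| ^ 4.
    rewrite (mul_energyE (sub0 _ B'A) us sB') (add_energyE (fset_uniq C)) // cB'.
    apply: leq_trans hs _; rewrite leq_mul2r; apply/orP; right.
    rewrite leq_mul2l; apply/orP; right.
    by rewrite leq_exp2r // fsubset_leq_card.
  have hU := mul_energy_disjointU (sub0 _ BA) (sub0 _ B'A) dBB' hB hB'.
  have UA : B `|` B' `<=` A by rewrite fsubUset BA.
  have cU : #|` B `|` B'| = (#|` B| + #|` B'|)%N by rewrite cardfsU (eqP dBB') cardfs0 subn0.
  have mono (X : {fset K}) : B `<=` X -> add_energy (A `\` X) ^ 3 <= add_energy C ^ 3.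
    by move=> BX; rewrite leq_exp2r // add_energy_mono // fsetDS.
  have [Um|mU] := ltnP #|` B `|` B'| m; [right | left].
    exists (B `|` B'); split; [exact: UA | | ].
      by rewrite Um andbT cU -addn1 leq_add // cB'.
    by apply: leq_trans (leq_mul (leqnn _) (mono _ _)) hU; apply: fsubsetUl.
  pose B2 := B `|` [fset x in take (m - #|` B|) s].
  have B2U : B2 `<=` B `|` B'.
    by apply: fsetUS; apply/fsubsetP => x; rewrite !inE => /mem_take.
  exists B2; split; first exact: fsubset_trans UA.
    rewrite cardfsU (_ : B `&` _ = fset0) ?cardfs0 ?subn0.
      rewrite card_fseq undup_id ?take_uniq // size_take_min -cB'.
      move: mU; rewrite cU => mU; rewrite (minn_idPl _) ?leq_subLR //.
      by rewrite subnKC // ltnW.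
    apply/fsetP => x; rewrite !inE; apply/andP => -[xB /mem_take].
    by rewrite sB'; apply/negP; apply: (fdisjointP dBB').
  apply: leq_trans (leq_mul (mul_energy_mono B2U) (mono _ (fsubsetUl _ _))) _.
  apply: leq_trans hU _.
  have -> : M * J ^ 10 * n ^ 11 = D * n ^ 4 by rewrite /D; ring.
  by rewrite leq_mul2l leq_exp2r // (fsubset_leq_card UA) orbT.
case: (step m) => // -[B [_ /andP[mB Bm] _]].
by move: (leq_ltn_trans mB Bm); rewrite ltnn.
Qed.

(** * The logarithmic loss *)

Local Open Scope ring_scope.

Lemma log2_ge1 (R : realType) (n : nat) : (1 < n)%N -> 1 <= log2 n%:R :> R.
Proof.
move=> n1; rewrite /log2 ler_pdivlMr ?ln_gt0 ?ltr1n // mul1r.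
by rewrite ler_ln ?posrE ?ltr0n ?ler_nat // ltnW.
Qed.

Lemma trunc_log_le_log2 (R : realType) (n : nat) :
  (0 < n)%N -> (trunc_log 2 n)%:R <= log2 n%:R :> R.
Proof.
move=> n0; rewrite /log2 ler_pdivlMr ?ln_gt0 ?ltr1n // mulr_natl -lnXn ?ltr0n //.
rewrite ler_ln ?posrE ?exprn_gt0 ?ltr0n // -natrX ler_nat.
by have /andP[] := trunc_log_bounds (isT : (1 < 2)%N) n0.
Qed.

Theorem theorem12 (R : realType) :
  exists2 C0 : R, 0 < C0 &
    forall A : {fset complex R}, 0 \notin A -> (1 < #|` A|)%N ->
    exists B C : {fset complex R},
      [/\ B `<=` A, C `<=` A & [disjoint B & C]%fset] /\
      [/\ #|` A|%:R / 3 <= #|` B|%:R :> R,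
          #|` A|%:R / 3 <= #|` C|%:R :> R
        & polylog_le C0 #|` A|
            ((mul_energy B)%:R * (add_energy C)%:R ^+ 3) (#|` A|%:R ^+ 11)].
Proof.
have [M HM] := balanced_split (@complex_rich_lines_bound R) isT.
(* M * 4 ^+ 10 is the constant obtained from J <= 4 * log2 n; the summand 10
   makes C0 at least as large as the exponent of the logarithm *)
pose C0 : R := M%:R * 4 ^+ 10 + 10%:R.
have M_ge0 : 0 <= M%:R * 4 ^+ 10 :> R by rewrite mulr_ge0 ?exprn_ge0 ?ler0n.
have C0_ge10 : 10%:R <= C0 by rewrite /C0 lerDr.
have C0_gt0 : 0 < C0 by apply: lt_le_trans C0_ge10; rewrite ltr0n.
exists C0 => // A A0 A1; set n := #|` A| in A1 *.
pose t := trunc_log 2 n; pose J := (2 * t.+1)%N.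
(* n / 3 rounded up, which leaves at least n / 3 elements because 1 < n *)
pose m := ((n + 2) %/ 3)%N.
have [|||B [BA cB hB]] := HM A J m A0.
- by [].
- rewrite /J mulnC expnM ltn_exp2r //; exact: trunc_log_ltn.
- by rewrite -/n /m; apply/andP; split; lia.
exists B, (A `\` B); split.
  split=> //; first exact: fsubsetDl.
  by apply/fdisjointP => x xB; rewrite inE xB.
have third k : (n <= 3 * k)%N -> n%:R / 3 <= k%:R :> R.
  by move=> nk; rewrite ler_pdivrMr ?ltr0n // mulrC -natrM ler_nat.
split.
- by apply: third; rewrite cB /m; lia.
- by apply: third; rewrite cardfsDS // cB -/n /m; lia.
rewrite /polylog_le -natrX -natrM.
set L := log2 n%:R.
have L1 : 1 <= L by apply: log2_ge1.
have JL : J%:R <= 4 * L.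
  rewrite /J natrM -natr1; have := @trunc_log_le_log2 R n (ltnW A1).
  by rewrite -/t -/L; lra.
apply: (@le_trans _ _ (M * J ^ 10 * n ^ 11)%N%:R); first by rewrite ler_nat.
rewrite natrM natrX; apply: ler_wpM2r; first by rewrite exprn_ge0 ?ler0n.
rewrite natrM natrX.
apply: (@le_trans _ _ (M%:R * (4 * L) ^+ 10)).
  rewrite ler_wpM2l ?ler0n // lerXn2r ?nnegrE ?ler0n //.
  by rewrite mulr_ge0 ?ler0n // (le_trans ler01).
rewrite exprMn mulrA; apply: ler_pM => //.
- by rewrite exprn_ge0 // (le_trans ler01).
- by rewrite /C0 lerDl.
rewrite -powR_mulrn ?(le_trans ler01) //; exact: ler_powR.
Qed.
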